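(* If $0<\lambda<1$ then $$F\Big(\frac14,\frac34;1;1-\lambda^2\Big)=\sqrt{\frac{2}{1+\lambda}}\;F\Big(\frac12,\frac12;1;\frac{1-\lambda}{1+\lambda}\Big).$$
   Context: $F={}_2F_1$ denotes the Gauss hypergeometric function, $F(a,b;c;z)=\sum_{n\ge0}\frac{(a)_n(b)_n}{(c)_n\,n!}z^n$ for $|z|<1$. *)

(* Defs.v *)
From Stdlib Require Import Reals Factorial.
From Coquelicot Require Import Coquelicot.
Open Scope R_scope.

(* Rising factorial: (a)_n = a (a+1) ... (a+n-1), with (a)_0 = 1. *)
Fixpoint pochhammer (a : R) (n : nat) : R :=
  match n with
  | O => 1
  | S m => pochhammer a m * (a + INR m)
  end.

Definition hyp2F1_coef (a b c : R) (n : nat) : R :=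
  pochhammer a n * pochhammer b n / (pochhammer c n * INR (fact n)).

(* Gauss hypergeometric function at real arguments. [PSeries] is total: the
   value is meaningful for |z| < 1 (where the series converges) and c not a
   nonpositive integer. *)
Definition hyp2F1 (a b c z : R) : R := PSeries (hyp2F1_coef a b c) z.

(* Main.v *)
Require Import Defs.
From Stdlib Require Import Reals Lra.
From Coquelicot Require Import Coquelicot.
Open Scope R_scope.

(** With [x = (1 - lambda) / (1 + lambda)] the claim becomes the quadratic
    transformation
    [F(1/4,3/4;1; 4x/(1+x)^2) = sqrt (1+x) * F(1/2,1/2;1; x)] for [0 <= x < 1].
    Both sides turn out to solve the same self-adjoint equation
    [(P y')' = q y], where [P = x(1-x)/(1+x)] and [q = (3/4)(1-x)/(1+x)^3].
    This rests on the fact that, when [a + b = 1], the hypergeometric equation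
    for [F = F(a,b;1;z)] has the self-adjoint form [(z(1-z) F')' = ab F]
    ([is_derive_hyp2F1_flux]); the substitution [z = 4x/(1+x)^2] turns
    [z(1-z) d/dz] into [P d/dx], and conjugation by [sqrt (1+x)] does the same
    for the second function.

    The equation is singular at [0] since [P 0 = 0], and this is what makes its
    regular solution unique up to scale: the weighted Wronskian
    [P (u' v - u v')] is constant and vanishes at [0], so [u / v] is constant
    ([proportional_of_singular_self_adjoint]). Both functions equal [1] at
    [0]. *)

(** * The Gauss series inside the unit disk *)

Lemma pochhammer_pos (a : R) (n : nat) : 0 < a -> 0 < pochhammer a n.
Proof.
  intros Ha; induction n as [|n IH]; simpl; [lra|].
  apply Rmult_lt_0_compat; [exact IH|]. pose proof (pos_INR n); lra.
Qed.

Lemma hyp2F1_coef_pos (a b c : R) (n : nat) :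
  0 < a -> 0 < b -> 0 < c -> 0 < hyp2F1_coef a b c n.
Proof.
  intros Ha Hb Hc; unfold hyp2F1_coef.
  apply Rdiv_lt_0_compat; apply Rmult_lt_0_compat;
    try apply INR_fact_lt_0; now apply pochhammer_pos.
Qed.

Lemma hyp2F1_coef_S (a b c : R) (n : nat) :
  0 < c ->
  hyp2F1_coef a b c (S n) =
  hyp2F1_coef a b c n * ((a + INR n) * (b + INR n) / ((c + INR n) * INR (S n))).
Proof.
  intros Hc; unfold hyp2F1_coef.
  rewrite fact_simpl, mult_INR; simpl pochhammer.
  pose proof (pos_INR n) as Hn.
  pose proof (pochhammer_pos c n Hc).
  pose proof (INR_fact_lt_0 n).
  rewrite S_INR; field; lra.
Qed.

Lemma is_lim_seq_shift_ratio (a c : R) :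
  0 < c -> is_lim_seq (fun n => (a + INR n) / (c + INR n)) 1.
Proof.
  intros Hc.
  apply is_lim_seq_ext with (fun n => 1 + (a - c) * / (c + INR n)).
  { intros n; pose proof (pos_INR n); field; lra. }
  replace (Finite 1) with (Finite (1 + (a - c) * 0)) by (f_equal; ring).
  apply is_lim_seq_plus'; [apply is_lim_seq_const|].
  apply (is_lim_seq_scal_l _ (a - c) 0).
  apply (is_lim_seq_inv _ p_infty); [|discriminate].
  apply is_lim_seq_plus with (Finite c) p_infty;
    [apply is_lim_seq_const | apply is_lim_seq_INR | reflexivity].
Qed.

Lemma CV_radius_hyp2F1 (a b c : R) :
  0 < a -> 0 < b -> 0 < c -> CV_radius (hyp2F1_coef a b c) = 1.
Proof.
  intros Ha Hb Hc.
  replace (Finite 1) with (Finite (/ (1 * 1))) by (f_equal; field).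
  apply CV_radius_finite_DAlembert; [|lra|].
  { intros n; apply Rgt_not_eq, hyp2F1_coef_pos; assumption. }
  apply is_lim_seq_ext with
    (fun n => ((a + INR n) / (c + INR n)) * ((b + INR n) / (1 + INR n))).
  - intros n; rewrite hyp2F1_coef_S by exact Hc.
    pose proof (hyp2F1_coef_pos a b c n Ha Hb Hc) as Hp.
    pose proof (pos_INR n) as Hn; rewrite S_INR.
    rewrite Rabs_right; [field; lra|].
    apply Rle_ge, Rlt_le.
    replace (hyp2F1_coef a b c n * _ / _) with
      ((a + INR n) * (b + INR n) / ((c + INR n) * (INR n + 1)))
      by (field; lra).
    apply Rdiv_lt_0_compat; apply Rmult_lt_0_compat; lra.
  - apply is_lim_seq_mult'; apply is_lim_seq_shift_ratio; lra.
Qed.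

Definition hyp2F1_deriv (a b c z : R) : R :=
  PSeries (PS_derive (hyp2F1_coef a b c)) z.

Lemma is_derive_hyp2F1 (a b c z : R) :
  0 < a -> 0 < b -> 0 < c -> Rabs z < 1 ->
  is_derive (hyp2F1 a b c) z (hyp2F1_deriv a b c z).
Proof.
  intros Ha Hb Hc Hz; apply is_derive_PSeries.
  rewrite CV_radius_hyp2F1 by assumption; exact Hz.
Qed.

Lemma hyp2F1_at_0 (a b c : R) : hyp2F1 a b c 0 = 1.
Proof.
  unfold hyp2F1; rewrite PSeries_0; unfold hyp2F1_coef; simpl; field.
Qed.

Lemma hyp2F1_pos (a b c z : R) :
  0 < a -> 0 < b -> 0 < c -> 0 <= z < 1 -> 0 < hyp2F1 a b c z.
Proof.
  intros Ha Hb Hc Hz.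
  assert (Hex : ex_pseries (hyp2F1_coef a b c) z).
  { apply CV_radius_inside; rewrite CV_radius_hyp2F1 by assumption.
    simpl; rewrite Rabs_right; lra. }
  assert (Hpos : forall n, 0 <= hyp2F1_coef a b c n * z ^ n).
  { intros n; apply Rmult_le_pos;
      [apply Rlt_le, hyp2F1_coef_pos; assumption | apply pow_le; lra]. }
  apply ex_pseries_R in Hex.
  unfold hyp2F1, PSeries; rewrite Series_incr_1 by exact Hex.
  assert (0 <= Series (fun k => hyp2F1_coef a b c (S k) * z ^ S k)).
  { apply ex_series_incr_1 in Hex.
    rewrite <- (Rmult_0_l (Series (fun k => hyp2F1_coef a b c (S k) * z ^ S k))).
    rewrite <- Series_scal_l; apply Series_le; [|exact Hex].
    intros n; rewrite Rmult_0_l; split; [apply Rle_refl | apply Hpos]. }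
  pose proof (hyp2F1_coef_pos a b c 0 Ha Hb Hc); rewrite pow_O; lra.
Qed.

(** The hypergeometric equation in self-adjoint form. In terms of the
    coefficients [f n] of [F], that of [z ^ n] in [(z F')' - (z ^ 2 F')'] is
    [(n+1)^2 f (n+1) - n (n+1) f n = ((a+n)(b+n) - n(n+1)) f n], which is
    [a b f n] exactly because [a + b = 1]. *)
Lemma is_derive_hyp2F1_flux (a b z : R) :
  0 < a -> 0 < b -> a + b = 1 -> Rabs z < 1 ->
  is_derive (fun y => y * (1 - y) * hyp2F1_deriv a b 1 y) z
    (a * b * hyp2F1 a b 1 z).
Proof.
  intros Ha Hb Hab Hz.
  set (f := hyp2F1_coef a b 1).
  assert (Hf : CV_radius f = 1) by (apply CV_radius_hyp2F1; lra).
  set (d1 := PS_incr_1 (PS_derive f) : nat -> R).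
  set (d2 := PS_incr_1 d1 : nat -> R).
  assert (H1 : CV_radius d1 = 1).
  { unfold d1; rewrite CV_radius_incr_1, CV_radius_derive; exact Hf. }
  assert (H2 : CV_radius d2 = 1).
  { unfold d2; rewrite CV_radius_incr_1; exact H1. }
  assert (E : a * b * hyp2F1 a b 1 z =
              PSeries (PS_derive d1) z - PSeries (PS_derive d2) z).
  { rewrite <- PSeries_minus by
      (apply CV_radius_inside; rewrite CV_radius_derive, ?H1, ?H2; exact Hz).
    unfold hyp2F1; rewrite <- PSeries_scal.
    apply PSeries_ext; intros n.
    unfold PS_scal, PS_minus, PS_derive, d2, d1, PS_incr_1, PS_derive, f,
      scal, plus, opp; simpl; unfold mult; simpl.
    pose proof (pos_INR n) as Hn.
    destruct n as [|n].
    - rewrite hyp2F1_coef_S by lra; simpl; unfold zero; simpl; field.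
    - fold (INR (S n)) in *. rewrite (hyp2F1_coef_S _ _ _ (S n)) by lra.
      change (match n with O => 1 | S _ => INR n + 1 end) with (INR (S n)).
      rewrite (S_INR (S n)) in *. replace b with (1 - a) by lra.
      field; lra. }
  rewrite E.
  apply is_derive_ext with (fun y => PSeries d1 y - PSeries d2 y).
  { intros y; unfold d2; rewrite PSeries_incr_1; unfold d1.
    rewrite PSeries_incr_1; unfold hyp2F1_deriv; fold f; cbn -[PSeries]; ring. }
  apply (is_derive_minus (PSeries d1) (PSeries d2));
    apply is_derive_PSeries; rewrite ?H1, ?H2; exact Hz.
Qed.

(** * Self-adjoint equations with a singular endpoint *)

(** The derivative of [P (u' v - u v')] is [q u v - u q v = 0], and [P 0 = 0]
    kills the constant; so [(u / v)' = 0] wherever [P] is positive. *)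
Lemma proportional_of_singular_self_adjoint
  (P q u v du dv : R -> R) (r : R) :
  0 < r ->
  (forall x, 0 <= x <= r -> is_derive u x (du x)) ->
  (forall x, 0 <= x <= r -> is_derive v x (dv x)) ->
  (forall x, 0 <= x <= r -> is_derive (fun y => P y * du y) x (q x * u x)) ->
  (forall x, 0 <= x <= r -> is_derive (fun y => P y * dv y) x (q x * v x)) ->
  P 0 = 0 ->
  (forall x, 0 < x <= r -> 0 < P x) ->
  (forall x, 0 <= x <= r -> 0 < v x) ->
  u r / v r = u 0 / v 0.
Proof.
  intros Hr Hu Hv HPu HPv HP0 HP Hvpos.
  set (W := fun y => P y * du y * v y - u y * (P y * dv y)).
  assert (HW : forall x, 0 < x <= r -> W x = 0).
  { intros x Hx.
    transitivity (W 0); [|unfold W; rewrite HP0; ring].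
    symmetry; apply eq_is_derive; [|lra].
    intros t Ht; assert (Ht' : 0 <= t <= r) by lra.
    pose proof (is_derive_mult _ _ t _ _ (HPu t Ht') (Hv t Ht') Rmult_comm) as D1.
    pose proof (is_derive_mult _ _ t _ _ (Hu t Ht') (HPv t Ht') Rmult_comm) as D2.
    pose proof (is_derive_minus _ _ t _ _ D1 D2) as D.
    refine (eq_ind _ (fun l => is_derive W t l) D _ _).
    unfold minus, plus, opp, mult, zero; simpl; ring. }
  assert (HD : forall x, 0 <= x <= r ->
    is_derive (fun y => u y / v y) x ((du x * v x - u x * dv x) / v x ^ 2)).
  { intros x Hx; apply is_derive_div; auto.
    specialize (Hvpos x Hx); lra. }
  destruct (MVT_gen (fun y => u y / v y) 0 r (fun _ => 0)) as [c [_ Hc]].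
  - rewrite Rmin_left, Rmax_right by lra; intros x Hx.
    assert (Hx' : 0 <= x <= r) by lra.
    replace 0 with ((du x * v x - u x * dv x) / v x ^ 2) at 1; [now apply HD|].
    assert (E : P x * (du x * v x - u x * dv x) = 0).
    { rewrite <- (HW x) by lra; unfold W; ring. }
    apply Rmult_integral in E; destruct E as [E|E].
    + assert (0 < P x) by (apply HP; lra); lra.
    + rewrite E; unfold Rdiv; ring.
  - rewrite Rmin_left, Rmax_right by lra; intros x Hx.
    apply continuity_pt_filterlim.
    apply (ex_derive_continuous (fun y => u y / v y)).
    eexists; now apply HD.
  - lra.
Qed.

(** * The quadratic transformation *)

(** With [x = k ^ 2], the square of the modulus [2 k / (1 + k ^ 2)]. It satisfies
    [1 - landen x = ((1 - x) / (1 + x)) ^ 2], so it maps [[0, 1)] into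
    itself. *)
Definition landen (x : R) : R := 4 * x / (1 + x) ^ 2.

Definition landen_deriv (x : R) : R := 4 * (1 - x) / (1 + x) ^ 3.

Lemma is_derive_landen (x : R) :
  -1 < x -> is_derive landen x (landen_deriv x).
Proof.
  intros Hx; unfold landen, landen_deriv; auto_derive.
  - apply Rgt_not_eq. nra.
  - field; lra.
Qed.

Lemma landen_bounds (x : R) : 0 <= x < 1 -> Rabs (landen x) < 1.
Proof.
  intros Hx.
  assert (E : landen x = 1 - ((1 - x) / (1 + x)) ^ 2)
    by (unfold landen; field; lra).
  assert (0 <= landen x)
    by (unfold landen; apply Rmult_le_pos;
        [lra | apply Rlt_le, Rinv_0_lt_compat, pow_lt; lra]).
  rewrite Rabs_right by lra.
  assert (0 < ((1 - x) / (1 + x)) ^ 2)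
    by (apply pow_lt, Rdiv_lt_0_compat; lra).
  lra.
Qed.

Definition weight (x : R) : R := x * (1 - x) / (1 + x).

Definition potential (x : R) : R := 3 / 4 * (1 - x) / (1 + x) ^ 3.

Section PulledBack.

Let u (x : R) : R := hyp2F1 (1 / 4) (3 / 4) 1 (landen x).
Let du (x : R) : R :=
  landen_deriv x * hyp2F1_deriv (1 / 4) (3 / 4) 1 (landen x).

Lemma is_derive_pulled_back (x : R) :
  0 <= x < 1 -> is_derive u x (du x).
Proof.
  intros Hx; unfold u, du.
  apply (is_derive_comp (hyp2F1 (1 / 4) (3 / 4) 1) landen).
  - apply is_derive_hyp2F1; [lra|lra|lra|now apply landen_bounds].
  - apply is_derive_landen; lra.
Qed.

(** With [z = landen x] one has [P z' = z (1 - z)], so [P d/dx = z (1-z) d/dz]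
    and the flux of [u] is the hypergeometric flux composed with [landen]. *)
Lemma is_derive_pulled_back_flux (x : R) :
  0 <= x < 1 ->
  is_derive (fun y => weight y * du y) x (potential x * u x).
Proof.
  intros Hx.
  (* The identity fails to make sense at [-1], hence is used only near [x]. *)
  apply is_derive_ext_loc with
    (fun y => landen y * (1 - landen y)
              * hyp2F1_deriv (1 / 4) (3 / 4) 1 (landen y)).
  { apply filter_imp with (fun y => -1 < y); [|apply (open_gt (-1)); lra].
    intros y Hy; unfold du.
    rewrite <- Rmult_assoc; f_equal.
    unfold weight, landen, landen_deriv; field; lra. }
  replace (potential x * u x) with
    (landen_deriv x * (1 / 4 * (3 / 4) * hyp2F1 (1 / 4) (3 / 4) 1 (landen x)))
    by (unfold potential, landen_deriv, u; field; lra).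
  apply (is_derive_comp
    (fun z => z * (1 - z) * hyp2F1_deriv (1 / 4) (3 / 4) 1 z) landen).
  - apply is_derive_hyp2F1_flux; [lra|lra|lra|now apply landen_bounds].
  - apply is_derive_landen; lra.
Qed.

End PulledBack.

Section Conjugated.

Let F (x : R) : R := hyp2F1 (1 / 2) (1 / 2) 1 x.
Let dF (x : R) : R := hyp2F1_deriv (1 / 2) (1 / 2) 1 x.
Let v (x : R) : R := sqrt (1 + x) * F x.
Let dv (x : R) : R := / (2 * sqrt (1 + x)) * F x + sqrt (1 + x) * dF x.

Lemma is_derive_sqrt_1p (x : R) :
  -1 < x -> is_derive (fun y => sqrt (1 + y)) x (/ (2 * sqrt (1 + x))).
Proof.
  intros Hx; auto_derive; [lra|].
  field; apply Rgt_not_eq, sqrt_lt_R0; lra.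
Qed.

Lemma is_derive_conjugated (x : R) :
  0 <= x < 1 -> is_derive v x (dv x).
Proof.
  intros Hx; unfold v, dv.
  apply (is_derive_mult (fun y => sqrt (1 + y)) F).
  - apply is_derive_sqrt_1p; lra.
  - apply is_derive_hyp2F1; [lra|lra|lra|rewrite Rabs_right; lra].
  - exact Rmult_comm.
Qed.

(** The flux splits as a multiple of [F] plus [B / sqrt (1+x)], where
    [B = x(1-x) F'] has derivative [F / 4]; on differentiating, the terms in
    [F'] cancel. *)
Lemma is_derive_conjugated_flux (x : R) :
  0 <= x < 1 ->
  is_derive (fun y => weight y * dv y) x (potential x * v x).
Proof.
  intros Hx.
  set (B := fun y => y * (1 - y) * dF y).
  assert (Habs : Rabs x < 1) by (rewrite Rabs_right; lra).
  assert (HB : is_derive B x (1 / 2 * (1 / 2) * F x))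
    by (apply is_derive_hyp2F1_flux; lra).
  assert (HF : is_derive F x (dF x)) by (apply is_derive_hyp2F1; lra).
  apply is_derive_ext_loc with
    (fun y => y * (1 - y) / (2 * sqrt (1 + y) ^ 3) * F y + B y / sqrt (1 + y)).
  { apply filter_imp with (fun y => -1 < y); [|apply (open_gt (-1)); lra].
    intros y Hy; unfold weight, dv, B.
    assert (Hs : 0 < sqrt (1 + y)) by (apply sqrt_lt_R0; lra).
    assert (Hss : sqrt (1 + y) * sqrt (1 + y) = 1 + y) by (apply sqrt_sqrt; lra).
    (* The sides are compared in the carrier of the normed module [R]; [field]
       expects an equation in [R]. *)
    match goal with |- ?l = ?r => change (@eq R l r) end.
    generalize (F y) (dF y); intros f f'.
    set (s := sqrt (1 + y)) in *; clearbody s.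
    (* In terms of [s] the identity is rational. *)
    replace y with (s * s - 1) by lra.
    field; nra. }
  assert (Hs : 0 < sqrt (1 + x)) by (apply sqrt_lt_R0; lra).
  assert (Hss : sqrt (1 + x) * sqrt (1 + x) = 1 + x) by (apply sqrt_sqrt; lra).
  auto_derive.
  - repeat split; try lra.
    + simpl; nra.
    + eexists; exact HF.
    + eexists; exact HB.
  - rewrite (is_derive_unique (fun y : R => F y) _ _ HF).
    rewrite (is_derive_unique (fun y : R => B y) _ _ HB).
    unfold potential, v, B.
    generalize (F x) (dF x); intros f f'.
    set (s := sqrt (1 + x)) in *; clearbody s.
    replace x with (s * s - 1) by lra.
    field; nra.
Qed.

Lemma conjugated_pos (x : R) : 0 <= x < 1 -> 0 < v x.
Proof.
  intros Hx; apply Rmult_lt_0_compat; [apply sqrt_lt_R0; lra|].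
  apply hyp2F1_pos; lra.
Qed.

End Conjugated.

Lemma hyp2F1_quadratic_transformation (x : R) :
  0 < x < 1 ->
  hyp2F1 (1 / 4) (3 / 4) 1 (landen x) =
  sqrt (1 + x) * hyp2F1 (1 / 2) (1 / 2) 1 x.
Proof.
  intros Hx.
  pose proof (conjugated_pos x ltac:(lra)) as Hv.
  assert (E := proportional_of_singular_self_adjoint weight potential
    _ _ _ _ x (proj1 Hx)
    (fun y Hy => is_derive_pulled_back y ltac:(lra))
    (fun y Hy => is_derive_conjugated y ltac:(lra))
    (fun y Hy => is_derive_pulled_back_flux y ltac:(lra))
    (fun y Hy => is_derive_conjugated_flux y ltac:(lra))
    ltac:(unfold weight; field)
    (fun y Hy => ltac:(unfold weight; apply Rdiv_lt_0_compat; nra))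
    (fun y Hy => conjugated_pos y ltac:(lra))).
  cbv beta in E.
  replace (landen 0) with 0 in E by (unfold landen; field).
  rewrite Rplus_0_r, sqrt_1, !hyp2F1_at_0 in E.
  apply Rmult_eq_reg_r with
    (/ (sqrt (1 + x) * hyp2F1 (1 / 2) (1 / 2) 1 x));
    [|apply Rinv_neq_0_compat; lra].
  rewrite Rinv_r by lra.
  unfold Rdiv at 1 in E; rewrite E; field.
Qed.

Theorem mainTheorem9 (lambda : R) (hlambda : 0 < lambda < 1) :
  hyp2F1 (1 / 4) (3 / 4) 1 (1 - lambda ^ 2) =
  sqrt (2 / (1 + lambda)) *
  hyp2F1 (1 / 2) (1 / 2) 1 ((1 - lambda) / (1 + lambda)).
Proof.
  set (x := (1 - lambda) / (1 + lambda)).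
  replace (1 - lambda ^ 2) with (landen x)
    by (unfold landen, x; field; lra).
  replace (2 / (1 + lambda)) with (1 + x) by (unfold x; field; lra).
  apply hyp2F1_quadratic_transformation; unfold x; split.
  - apply Rdiv_lt_0_compat; lra.
  - apply Rmult_lt_reg_r with (1 + lambda); [lra|].
    unfold Rdiv; rewrite Rmult_assoc, Rinv_l; lra.
Qed.
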